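(* For $\mu\in\mathcal P$ and $1\le i\le P$, let $d_{\mu_i}p_{h,\mu}\in V_h$ be the solution of $$a_\mu(q_h,d_{\mu_i}p_{h,\mu})=d_{\mu_i}r^{\mathrm{du}}_\mu(u_{h,\mu},p_{h,\mu})[q_h]+2k_\mu(q_h,d_{\mu_i}u_{h,\mu})\quad\text{for all }q_h\in V_h,$$ and let $d_{\mu_i}p_{r,\mu}\in V_r^{\mathrm{du}}$ be the solution of $$a_\mu(q_r,d_{\mu_i}p_{r,\mu})=d_{\mu_i}r^{\mathrm{du}}_\mu(u_{r,\mu},p_{r,\mu})[q_r]+2k_\mu(q_r,d_{\mu_i}u_{r,\mu})\quad\text{for all }q_r\in V_r^{\mathrm{du}}.$$ Then $\|d_{\mu_i}p_{h,\mu}-d_{\mu_i}p_{r,\mu}\|\le\Delta_{d_{\mu_i}\mathrm{du}}(\mu)$ with $$\Delta_{d_{\mu_i}\mathrm{du}}(\mu):=\underline{a_\mu}^{-1}\Big(2\gamma_{d_{\mu_i}k_\mu}\Delta_{\mathrm{pr}}(\mu)+\gamma_{d_{\mu_i}a_\mu}\Delta_{\mathrm{du}}(\mu)+2\gamma_{k_\mu}\Delta_{d_{\mu_i}\mathrm{pr}}(\mu)+\|r^{\mathrm{du},d_{\mu_i}}_\mu(u_{r,\mu},p_{r,\mu},d_{\mu_i}u_{r,\mu},d_{\mu_i}p_{r,\mu})\|\Big).$$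
   Context: Setting. Let $P\in\mathbb N$, $\mu_{\mathsf a},\mu_{\mathsf b}\in\mathbb R^P$, and $\mathcal P=\{\mu\in\mathbb R^P: \mu_{\mathsf a}\le\mu\le\mu_{\mathsf b}\}$ (componentwise). $V$ is a real Hilbert space with norm $\|\cdot\|$, and $V_h\subset V$ is a finite-dimensional subspace. For each $\mu\in\mathcal P$: $a_\mu:V\times V\to\mathbb R$ is a continuous, coercive, symmetric bilinear form; $l_\mu,j_\mu\in V'$; $k_\mu:V\times V\to\mathbb R$ is a continuous symmetric bilinear form; $\Theta:\mathcal P\to\mathbb R$. All forms are parameter separable, i.e. $a_\mu=\sum_{\xi}\theta^a_\xi(\mu)a_\xi$ is a finite sum with parameter-independent components, and similarly for $l_\mu,j_\mu,k_\mu$. With $\mathcal J(u,\mu)=\Theta(\mu)+j_\mu(u)+k_\mu(u,u)$, it is assumed that $a_\mu,l_\mu,\mathcal J$ (hence all coefficient functions) are twice Fréchet differentiable with respect to $\mu$. Notation. $d_{\mu_i}$ is the partial derivative with respect to the $i$-th component of $\mu$; $d_{\mu_i}a_\mu$ etc. are obtained by differentiating the coefficients. Residuals: $r^{\mathrm{pr}}_\mu(u)[v]=l_\mu(v)-a_\mu(u,v)$ and $r^{\mathrm{du}}_\mu(u,p)[v]=j_\mu(v)+2k_\mu(v,u)-a_\mu(v,p)$; $d_{\mu_i}r^{\mathrm{pr}}_\mu(u)[v]=d_{\mu_i}l_\mu(v)-d_{\mu_i}a_\mu(u,v)$ and $d_{\mu_i}r^{\mathrm{du}}_\mu(u,p)[v]=d_{\mu_i}j_\mu(v)+2d_{\mu_i}k_\mu(v,u)-d_{\mu_i}a_\mu(v,p)$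 (arguments $u,p,v$ held fixed, also when evaluated at $\mu$-dependent functions). Sensitivity residuals: $r^{\mathrm{pr},d_{\mu_i}}_\mu(u,u')[v]=d_{\mu_i}r^{\mathrm{pr}}_\mu(u)[v]-a_\mu(u',v)$ and $r^{\mathrm{du},d_{\mu_i}}_\mu(u,p,u',p')[q]=d_{\mu_i}r^{\mathrm{du}}_\mu(u,p)[q]+2k_\mu(q,u')-a_\mu(q,p')$ for arguments in $V_h$. Full order model. $u_{h,\mu}\in V_h$ solves $a_\mu(u_{h,\mu},v_h)=l_\mu(v_h)$; $p_{h,\mu}\in V_h$ solves $a_\mu(v_h,p_{h,\mu})=j_\mu(v_h)+2k_\mu(v_h,u_{h,\mu})$; $d_{\mu_i}u_{h,\mu}\in V_h$ solves $a_\mu(d_{\mu_i}u_{h,\mu},v_h)=d_{\mu_i}r^{\mathrm{pr}}_\mu(u_{h,\mu})[v_h]$; each for all $v_h\in V_h$. Reduced basis model. $V_r^{\mathrm{pr}},V_r^{\mathrm{du}}\subset V_h$ are (possibly different) linear subspaces. $u_{r,\mu}\in V_r^{\mathrm{pr}}$ solves $a_\mu(u_{r,\mu},v_r)=l_\mu(v_r)$ for all $v_r\in V_r^{\mathrm{pr}}$; $p_{r,\mu}\in V_r^{\mathrm{du}}$ solves $a_\mu(q_r,p_{r,\mu})=j_\mu(q_r)+2k_\mu(q_r,u_{r,\mu})$ for all $q_r\in V_r^{\mathrm{du}}$; $d_{\mu_i}u_{r,\mu}\in V_r^{\mathrm{pr}}$ solves $a_\mu(d_{\mu_i}u_{r,\mu},v_r)=d_{\mu_i}r^{\mathrm{pr}}_\mu(u_{r,\mu})[v_r]$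 for all $v_r\in V_r^{\mathrm{pr}}$. Norms, constants, estimators. Norms of residuals are dual norms in $V_h'$ with respect to $\|\cdot\|$; for a bilinear form $b$ on $V_h$, $\gamma_b$ is its continuity constant; $\underline{a_\mu}>0$ is the coercivity constant of $a_\mu$ on $V_h$. $\Delta_{\mathrm{pr}}(\mu)=\underline{a_\mu}^{-1}\|r^{\mathrm{pr}}_\mu(u_{r,\mu})\|$; $\Delta_{\mathrm{du}}(\mu)=\underline{a_\mu}^{-1}\big(2\gamma_{k_\mu}\Delta_{\mathrm{pr}}(\mu)+\|r^{\mathrm{du}}_\mu(u_{r,\mu},p_{r,\mu})\|\big)$; $\Delta_{d_{\mu_i}\mathrm{pr}}(\mu)=\underline{a_\mu}^{-1}\big(\gamma_{d_{\mu_i}a_\mu}\Delta_{\mathrm{pr}}(\mu)+\|r^{\mathrm{pr},d_{\mu_i}}_\mu(u_{r,\mu},d_{\mu_i}u_{r,\mu})\|\big)$. *)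

(* Defs.v *)
From HB Require Import structures.
From mathcomp Require Import all_boot all_order all_algebra.
From mathcomp Require Import all_classical all_reals all_analysis.
Set Implicit Arguments.
Unset Strict Implicit.
Unset Printing Implicit Defensive.
Import Order.TTheory GRing.Theory Num.Theory.
Import numFieldNormedType.Exports.
Local Open Scope classical_set_scope.
Local Open Scope ring_scope.

Definition box (R : realType) (P : nat) (mua mub : 'rV[R]_P) : set 'rV[R]_P :=
  [set mu | forall i, mua 0 i <= mu 0 i <= mub 0 i].

Definition partial (R : realType) (P : nat) (i : 'I_P) (f : 'rV[R]_P -> R)
    (mu : 'rV[R]_P) : R :=
  'D_(delta_mx 0 i) f mu.

(* Where f is Frechet differentiable, its derivative is represented by the row
   of its partial derivatives. *)
Definition twice_differentiable_at (R : realType) (P : nat)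
    (f : 'rV[R]_P -> R) (mu : 'rV[R]_P) : Prop :=
  (\forall x \near mu, differentiable f x) /\
  differentiable (fun x => \row_i partial i f x) mu.

(* V, complete for its norm, is a Hilbert space when the norm is induced by an
   inner product. *)
Definition is_hilbert (R : realType) (V : completeNormedModType R) : Prop :=
  exists dot : {dot V for idfun}, forall v : V, `|v| ^+ 2 = dot v v.

Section Subspace.
Variables (R : realType) (V : normedModType R).

Definition finite_dimensional (W : {pred V}) : Prop :=
  exists n (b : 'I_n -> V),
    {in W, forall v, exists c : 'I_n -> R, v = \sum_(i < n) c i *: b i}.

Definition continuous_form (b : V -> V -> R) : Prop :=
  continuous (fun x : V * V => b x.1 x.2).

Definition coercive_form (b : V -> V -> R) : Prop :=
  exists2 c : R, 0 < c & forall v, c * `|v| ^+ 2 <= b v v.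

Definition nonzero_of (W : {pred V}) : set V := [set v | v \in W /\ v != 0].

(* If W = 0, the sets below are empty and the three constants are 0 since
   sup set0 = inf set0 = 0. *)
Definition dual_norm (W : {pred V}) (f : V -> R) : R :=
  sup [set `|f v| / `|v| | v in nonzero_of W].

Definition continuity_const (W : {pred V}) (b : V -> V -> R) : R :=
  sup [set `|b u v| / (`|u| * `|v|) | u in nonzero_of W & v in nonzero_of W].

Definition coercivity_const (W : {pred V}) (b : V -> V -> R) : R :=
  inf [set b v v / `|v| ^+ 2 | v in nonzero_of W].

End Subspace.

(* Parameter-separable forms: the components do not depend on the parameter. *)
Record sep_linform (R : realType) (V : normedModType R) (P : nat) := SepLinform {
  lin_card : nat;
  lin_coef : 'I_lin_card -> 'rV[R]_P -> R;
  lin_comp : 'I_lin_card -> {scalar V} }.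

Record sep_bilform (R : realType) (V : normedModType R) (P : nat) := SepBilform {
  bil_card : nat;
  bil_coef : 'I_bil_card -> 'rV[R]_P -> R;
  bil_comp : 'I_bil_card -> {biscalar V} }.

Arguments lin_coef {R V P} _ _ _.
Arguments lin_comp {R V P} _ _.
Arguments bil_coef {R V P} _ _ _.
Arguments bil_comp {R V P} _ _.

Section Problem.
Variables (R : realType) (V : normedModType R) (P : nat).
Implicit Types (mu : 'rV[R]_P) (W : {pred V}).

Definition lin (l : sep_linform V P) mu (v : V) : R :=
  \sum_q lin_coef l q mu * lin_comp l q v.

Definition dlin (i : 'I_P) (l : sep_linform V P) mu (v : V) : R :=
  \sum_q partial i (lin_coef l q) mu * lin_comp l q v.

Definition bil (b : sep_bilform V P) mu (u v : V) : R :=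
  \sum_q bil_coef b q mu * bil_comp b q u v.

Definition dbil (i : 'I_P) (b : sep_bilform V P) mu (u v : V) : R :=
  \sum_q partial i (bil_coef b q) mu * bil_comp b q u v.

Variables (a k : sep_bilform V P) (l j : sep_linform V P).

Definition objective (Theta : 'rV[R]_P -> R) (u : V) mu : R :=
  Theta mu + lin j mu u + bil k mu u u.

Definition res_pr mu (u v : V) : R := lin l mu v - bil a mu u v.

Definition res_du mu (u p v : V) : R :=
  lin j mu v + 2 * bil k mu v u - bil a mu v p.

Definition dres_pr (i : 'I_P) mu (u v : V) : R :=
  dlin i l mu v - dbil i a mu u v.

Definition dres_du (i : 'I_P) mu (u p v : V) : R :=
  dlin i j mu v + 2 * dbil i k mu v u - dbil i a mu v p.

Definition sens_res_pr (i : 'I_P) mu (u du v : V) : R :=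
  dres_pr i mu u v - bil a mu du v.

Definition sens_res_du (i : 'I_P) mu (u p du dp q : V) : R :=
  dres_du i mu u p q + 2 * bil k mu q du - bil a mu q dp.

(* Galerkin solutions in W: the full order model is W = Vh, the reduced one has
   W the primal or the dual reduced space. *)
Definition primal_sol W mu (u : V) : Prop :=
  u \in W /\ {in W, forall v, bil a mu u v = lin l mu v}.

Definition dual_sol W mu (u p : V) : Prop :=
  p \in W /\ {in W, forall q, bil a mu q p = lin j mu q + 2 * bil k mu q u}.

Definition dprimal_sol W (i : 'I_P) mu (u du : V) : Prop :=
  du \in W /\ {in W, forall v, bil a mu du v = dres_pr i mu u v}.

Definition ddual_sol W (i : 'I_P) mu (u p du dp : V) : Prop :=
  dp \in W /\
  {in W, forall q, bil a mu q dp = dres_du i mu u p q + 2 * bil k mu q du}.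

Variable Vh : {pred V}.

Definition Delta_pr mu (ur : V) : R :=
  (coercivity_const Vh (bil a mu))^-1 * dual_norm Vh (res_pr mu ur).

Definition Delta_du mu (ur pr : V) : R :=
  (coercivity_const Vh (bil a mu))^-1 *
  (2 * continuity_const Vh (bil k mu) * Delta_pr mu ur +
   dual_norm Vh (res_du mu ur pr)).

Definition Delta_dpr (i : 'I_P) mu (ur dur : V) : R :=
  (coercivity_const Vh (bil a mu))^-1 *
  (continuity_const Vh (dbil i a mu) * Delta_pr mu ur +
   dual_norm Vh (sens_res_pr i mu ur dur)).

Definition Delta_ddu (i : 'I_P) mu (ur pr dur dpr : V) : R :=
  (coercivity_const Vh (bil a mu))^-1 *
  (2 * continuity_const Vh (dbil i k mu) * Delta_pr mu ur +
   continuity_const Vh (dbil i a mu) * Delta_du mu ur pr +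
   2 * continuity_const Vh (bil k mu) * Delta_dpr i mu ur dur +
   dual_norm Vh (sens_res_du i mu ur pr dur dpr)).

End Problem.

(* Main.v *)
(* Subtracting the reduced equations from the full ones, each of the four errors
   (primal, dual and their sensitivities) solves a problem with the form
   [a_mu] on V_h, whose right-hand side is a residual plus terms in the previous
   errors; testing with the error itself and using coercivity bounds its norm.
   The dual norms and continuity constants are suprema of bounded sets because
   V_h is finite-dimensional: the components of the forms need not be bounded on
   V, but Gram-Schmidt gives coordinates on V_h bounded by the norm. *)
From HB Require Import structures.
Require Import Defs.
From mathcomp Require Import all_boot all_order all_algebra.
From mathcomp Require Import all_classical all_reals all_analysis.
From mathcomp Require Import ring lra.
Set Implicit Arguments.
Unset Strict Implicit.
Unset Printing Implicit Defensive.
Import Order.TTheory GRing.Theory Num.Theory.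
Import numFieldNormedType.Exports.
Local Open Scope classical_set_scope.
Local Open Scope ring_scope.

(** * Cauchy-Schwarz and Gram-Schmidt for the inner product inducing the norm *)

Section InnerProduct.
Variables (R : realType) (V : normedModType R) (dot : {dot V for idfun}).
Hypothesis dot_norm : forall v : V, `|v| ^+ 2 = dot v v.

Lemma dot_sym u v : dot u v = dot v u.
Proof. by rewrite hermC expr0 mul1r. Qed.

(** Cauchy-Schwarz from the triangle inequality: expanding both sides of [|x + v| ^+ 2 <= (]|x| +
    [|v|) ^+ 2] leaves the upper bound, and [x := - u] gives the lower one. *)
Lemma dot_le_norm u v : `|dot u v| <= `|u| * `|v|.
Proof.
have upper x : dot x v <= `|x| * `|v|.
  have sq : `|x + v| ^+ 2 <= (`|x| + `|v|) ^+ 2.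
    by rewrite lerXn2r ?nnegrE ?addr_ge0 ?ler_normD.
  have polar : `|x + v| ^+ 2 = `|x| ^+ 2 + `|v| ^+ 2 + 2 * dot x v.
    by rewrite !dot_norm linearDl /= !linearDr /= (dot_sym v x); ring.
  by move: sq; rewrite polar sqrrD; lra.
rewrite ler_norml upper andbT.
by have := upper (- u); rewrite linearNl normrN; lra.
Qed.

(* A zero vector in [s] contributes 0, as [_ / 0 = 0]: no vector has to be
   discarded in the Gram-Schmidt process. *)
Definition proj (s : seq V) (v : V) : V :=
  \sum_(e <- s) (dot v e / dot e e) *: e.

Lemma projDZ s c u v : proj s (c *: u + v) = c *: proj s u + proj s v.
Proof.
rewrite /proj scaler_sumr -big_split; apply: eq_bigr => e _ /=.
by rewrite linearDl linearZl_LR /= scalerA mulrDl scalerDl mulrA.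
Qed.

(** Induction on [n]: the list for the other vectors is extended by the residual [r] of [b ord0].
    The orthogonality clause carries the induction, since it makes [r] orthogonal to [s]. *)
Lemma gram_schmidt n (b : 'I_n -> V) : exists s,
  (forall v, {in s, forall e, dot (v - proj s v) e = 0}) /\
  forall i, proj s (b i) = b i.
Proof.
elim: n b => [|n IHn] b; first by exists [::]; split=> // -[].
have [s [orth fixb]] := IHn (fun i => b (lift ord0 i)).
set r := b ord0 - proj s (b ord0).
have orth_r : {in s, forall e, dot e r = 0}.
  by move=> e es; rewrite dot_sym orth.
have proj_r v : dot (proj s v) r = 0.
  rewrite /proj linear_sumlz big_seq big1 // => e es.
  by rewrite linearZl_LR /= orth_r ?mulr0.
have projE v : proj (r :: s) v = (dot v r / dot r r) *: r + proj s v.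
  by rewrite /proj big_cons.
have dotrr : dot r r = dot (b ord0) r.
  by rewrite {1}/r linearBl /= proj_r subr0.
have dot0 x : dot r r = 0 -> dot x r = 0.
  rewrite -dot_norm => /eqP; rewrite sqrf_eq0 normr_eq0 => /eqP ->.
  by rewrite linear0r.
exists (r :: s); split=> [v e|i].
  rewrite projE opprD addrCA addrC inE => /predU1P[->|es].
    rewrite linearDl linearBl linearNl linearZl_LR /= proj_r subr0.
    have [rr0|rr0] := eqVneq (dot r r) 0.
      by rewrite rr0 (dot0 v rr0) !mul0r subr0.
    by rewrite divfK ?subrr.
  by rewrite linearDl linearNl linearZl_LR /= orth // (dot_sym r e) orth_r // mulr0 subr0.
(* The other vectors are fixed by [proj s], hence orthogonal to [r], and the new term vanishes. For
   [b ord0] the new coefficient is 1 by [dotrr], unless [r = 0], and then [proj s] already fixes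
   [b ord0]. *)
rewrite projE; case: (unliftP ord0 i) => [j ->|->].
  by rewrite -[in dot _ _]fixb proj_r mul0r scale0r add0r fixb.
have [rr0|rr0] := eqVneq (dot r r) 0.
  rewrite rr0 invr0 mulr0 scale0r add0r; apply/esym/eqP.
  by rewrite -subr_eq0 -normr_eq0 -sqrf_eq0 dot_norm rr0.
by rewrite -dotrr divff // scale1r subrK.
Qed.

End InnerProduct.

(** * Bounds for forms on a finite-dimensional set of vectors, and the coercivity estimate *)

Section Bounds.
Variables (R : realType) (V : completeNormedModType R).
Hypothesis hV : is_hilbert V.
Variable W : {pred V}.
Hypothesis W_fin : finite_dimensional W.

Lemma bounded_coordinates : exists s : seq V,
  {in W, forall v, exists2 c : V -> R,
    v = \sum_(e <- s) c e *: e & forall e, `|c e| <= `|v| / `|e|}.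
Proof.
have [dot dotE] := hV; have [n [b Wb]] := W_fin.
have [s [_ fixb]] := gram_schmidt dotE b.
exists s => v /Wb[c vE]; exists (fun e => dot v e / dot e e).
  rewrite -[RHS]/(proj dot s v) vE.
  (* [proj s] is linear and fixes each [b i], so it fixes their combinations. *)
  elim/big_ind: _ => [|x y xE yE|i _].
  - by rewrite /proj big1 // => e _; rewrite linear0l mul0r scale0r.
  - by rewrite -[in RHS](scale1r x) projDZ -xE -yE scale1r.
  - rewrite -[in RHS](addr0 (c i *: b i)) projDZ fixb /proj big1 ?addr0 // => e _.
    by rewrite linear0l mul0r scale0r.
move=> e; have [->|e0] := eqVneq e 0.
  by rewrite linear0r mul0r normr0 divr_ge0.
rewrite -dotE normf_div [`| `|e| ^+ 2|]ger0_norm ?exprn_ge0 //.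
rewrite ler_pdivrMr ?exprn_gt0 ?normr_gt0 // expr2 mulrA divfK ?normr_eq0 //.
exact: dot_le_norm.
Qed.

(** Expand [v] in bounded coordinates. The list [s] is chosen before [f], so that one list serves
    both slots of a bilinear form. *)
Lemma linear_bound : exists s : seq V, forall f : {scalar V},
  {in W, forall v, `|f v| <= (\sum_(e <- s) `|f e| / `|e|) * `|v|}.
Proof.
have [s Ws] := bounded_coordinates; exists s => f v /Ws[c vE c_le].
rewrite {1}vE linear_sum mulr_suml (le_trans (ler_norm_sum _ _ _)) //.
apply: ler_sum => e _; rewrite linearZ normrM mulrAC -mulrA mulrC.
by rewrite ler_wpM2l.
Qed.

Lemma bilinear_bound (b : {biscalar V}) : exists M,
  {in W &, forall u v, `|b u v| <= M * (`|u| * `|v|)}.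
Proof.
have [s bnd] := linear_bound.
(* The constant comes from bounding [b] in its first slot with [v] fixed, then each [b e] in its
   second slot. *)
exists (\sum_(e <- s) (\sum_(d <- s) `|b e d| / `|d|) / `|e|) => u v uW vW.
apply: (le_trans (bnd (applyr b v) u uW)) => /=.
rewrite [leRHS]mulrA [leRHS]mulrAC ler_wpM2r // mulr_suml.
apply: ler_sum => e _; rewrite mulrAC ler_wpM2r ?invr_ge0 //.
exact: (bnd (b e) v vW).
Qed.

(** If [E] is empty or unbounded above, [sup E] takes its default value 0. *)
Lemma sup_ge0 (E : set R) : (forall x, E x -> 0 <= x) -> 0 <= sup E.
Proof.
move=> E_ge0; have [supE|/sup_out -> //] := pselect (has_sup E).
have [[x Ex] _] := supE.
exact: le_trans (E_ge0 _ Ex) (sup_upper_bound supE Ex).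
Qed.

Lemma dual_norm_ge0 f : 0 <= dual_norm W f.
Proof. by apply: sup_ge0 => _ [v _ <-]; rewrite divr_ge0. Qed.

Lemma continuity_const_ge0 b : 0 <= continuity_const W b.
Proof. by apply: sup_ge0 => _ [u _ [v _ <-]]; rewrite divr_ge0 ?mulr_ge0. Qed.

(** A supremum dominates its set only if the set is bounded above; [linear_bound] supplies such a
    bound. *)
Lemma dual_normP (f : {scalar V}) :
  {in W, forall v, `|f v| <= dual_norm W f * `|v|}.
Proof.
move=> v vW; have [->|v0] := eqVneq v 0; first by rewrite linear0 !normr0 mulr0.
rewrite -ler_pdivrMr ?normr_gt0 //; apply: ub_le_sup; last by exists v.
have [s bnd] := linear_bound; exists (\sum_(e <- s) `|f e| / `|e|).
by move=> _ [x [xW x0] <-]; rewrite ler_pdivrMr ?normr_gt0 ?bnd.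
Qed.

Lemma continuity_constP (b : {biscalar V}) :
  {in W &, forall u v, `|b u v| <= continuity_const W b * (`|u| * `|v|)}.
Proof.
move=> u v uW vW.
have [->|u0] := eqVneq u 0; first by rewrite linear0l !normr0 mul0r mulr0.
have [->|v0] := eqVneq v 0; first by rewrite linear0r !normr0 !mulr0.
rewrite -ler_pdivrMr ?mulr_gt0 ?normr_gt0 //.
apply: ub_le_sup; last by exists u => //; exists v.
have [M bnd] := bilinear_bound b; exists M => _ [x [xW x0] [y [yW y0] <-]].
by rewrite ler_pdivrMr ?mulr_gt0 ?normr_gt0 ?bnd.
Qed.

(** Here [u] is meant to be an earlier error with known bound [D], and [v] the test vector. In the
    dual equations these slots are exchanged, hence the second version below. *)
Lemma form_le_l (b : {biscalar V}) u v D : u \in W -> v \in W -> `|u| <= D ->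
  `|b u v| <= continuity_const W b * D * `|v|.
Proof.
move=> uW vW uD; rewrite (le_trans (continuity_constP _ uW vW)) // -mulrA.
by rewrite ler_wpM2l ?continuity_const_ge0 // ler_wpM2r.
Qed.

Lemma form_le_r (b : {biscalar V}) u v D : u \in W -> v \in W -> `|v| <= D ->
  `|b u v| <= continuity_const W b * D * `|u|.
Proof.
move=> uW vW vD; rewrite (le_trans (continuity_constP _ uW vW)) // -mulrA.
by rewrite ler_wpM2l ?continuity_const_ge0 // mulrC ler_wpM2r.
Qed.

(** The infimum of the Rayleigh quotients is at least [c > 0], and its product with [|e| ^+ 2] is at
    most [b e e <= D * |e|]; divide by [|e|]. *)
Lemma coercive_error (b : V -> V -> R) (e : V) (D : R) :
  coercive_form b -> e \in W -> 0 <= D -> b e e <= D * `|e| ->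
  `|e| <= (coercivity_const W b)^-1 * D.
Proof.
move=> [c c0 bc] eW D0 beD.
set E := [set b v v / `|v| ^+ 2 | v in nonzero_of W].
have E_lb : lbound E c.
  by move=> _ [v [_ v0] <-]; rewrite ler_pdivlMr ?exprn_gt0 ?normr_gt0.
have [->|e0] := eqVneq e 0.
  rewrite normr0 mulr_ge0 // invr_ge0 /coercivity_const -/E.
  (* For [e = 0] only the sign of the right-hand side matters; if [W] has no nonzero vector, the
     constant is 0 and so is its inverse. *)
  have [->|/set0P E0] := eqVneq E set0; first by rewrite inf0.
  exact: le_trans (ltW c0) (lb_le_inf E0 E_lb).
have Ee : E (b e e / `|e| ^+ 2) by exists e.
have const_gt0 : 0 < coercivity_const W b.
  by apply: lt_le_trans c0 _; apply: lb_le_inf => //; exists (b e e / `|e| ^+ 2).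
rewrite ler_pdivlMl // -(ler_pM2r (x := `|e|)) ?normr_gt0 //.
apply: le_trans beD; rewrite -mulrA -expr2.
rewrite -ler_pdivlMr ?exprn_gt0 ?normr_gt0 //.
by apply: ge_inf => //; exists c.
Qed.

End Bounds.

(** * Linearity of the parametric forms, and of the residuals in the test vector *)

Section Forms.
Variables (R : realType) (V : normedModType R) (P : nat).
Implicit Types (mu : 'rV[R]_P) (i : 'I_P).
Implicit Types (a k b : sep_bilform V P) (l j : sep_linform V P).

Lemma scalar_sum n (c : 'I_n -> R) (f : 'I_n -> {scalar V}) :
  scalar (fun v => \sum_q c q * f q v).
Proof.
move=> x u v /=; rewrite mulr_sumr -big_split; apply: eq_bigr => q _ /=.
by rewrite linearP /=; ring.
Qed.

Lemma biscalar_sum n (c : 'I_n -> R) (b : 'I_n -> {biscalar V}) :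
  bilinear_for *%R *%R (fun u v => \sum_q c q * b q u v).
Proof.
split=> w; first exact: (scalar_sum c (fun q => applyr (b q) w)).
exact: (scalar_sum c (fun q => b q w)).
Qed.

(** With these instances the bounds on [{scalar V}] and [{biscalar V}] apply to the forms at a fixed
    parameter. *)
HB.instance Definition _ l mu :=
  GRing.isLinear.Build R V R _ (lin l mu) (scalar_sum _ _).
HB.instance Definition _ i l mu :=
  GRing.isLinear.Build R V R _ (Defs.dlin i l mu) (scalar_sum _ _).
HB.instance Definition _ b mu :=
  bilinear_isBilinear.Build R V V R _ _ (bil b mu) (biscalar_sum _ _).
HB.instance Definition _ i b mu :=
  bilinear_isBilinear.Build R V V R _ _ (dbil i b mu) (biscalar_sum _ _).

Lemma res_pr_scalar a l mu u : scalar (res_pr a l mu u).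
Proof. by move=> c x y; rewrite /res_pr linearP linearPr /=; ring. Qed.

HB.instance Definition _ a l mu u :=
  GRing.isLinear.Build R V R _ (res_pr a l mu u) (res_pr_scalar a l mu u).

Lemma res_du_scalar a k j mu u p : scalar (res_du a k j mu u p).
Proof.
move=> c x y; rewrite /res_du linearP !linearDl !linearZl_LR /=; ring.
Qed.

HB.instance Definition _ a k j mu u p :=
  GRing.isLinear.Build R V R _ (res_du a k j mu u p)
    (res_du_scalar a k j mu u p).

Lemma sens_res_pr_scalar a l i mu u du : scalar (sens_res_pr a l i mu u du).
Proof.
move=> c x y; rewrite /sens_res_pr /dres_pr linearP !linearPr /=; ring.
Qed.

HB.instance Definition _ a l i mu u du :=
  GRing.isLinear.Build R V R _ (sens_res_pr a l i mu u du)
    (sens_res_pr_scalar a l i mu u du).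

Lemma sens_res_du_scalar a k j i mu u p du dp :
  scalar (sens_res_du a k j i mu u p du dp).
Proof.
move=> c x y.
rewrite /sens_res_du /dres_du linearP !linearDl !linearZl_LR /=; ring.
Qed.

HB.instance Definition _ a k j i mu u p du dp :=
  GRing.isLinear.Build R V R _ (sens_res_du a k j i mu u p du dp)
    (sens_res_du_scalar a k j i mu u p du dp).

End Forms.

(** * The four error estimates, each feeding the later ones *)

Section Estimators.
Variables (R : realType) (V : completeNormedModType R) (P : nat).
Hypothesis hV : is_hilbert V.
Variables (a k : sep_bilform V P) (l j : sep_linform V P).
Variables (Vh Vpr Vdu : {pred V}) (mu : 'rV[R]_P) (i : 'I_P).
Hypotheses (Vh_sub : GRing.submod_closed Vh) (Vh_fin : finite_dimensional Vh).
Hypotheses (Vpr_Vh : {subset Vpr <= Vh}) (Vdu_Vh : {subset Vdu <= Vh}).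
Hypothesis a_coer : coercive_form (bil a mu).
Variables uh ph duh dph ur pr dur dpr : V.
Hypotheses (huh : primal_sol a l Vh mu uh) (hur : primal_sol a l Vpr mu ur).
Hypotheses (hph : dual_sol a k j Vh mu uh ph)
  (hpr : dual_sol a k j Vdu mu ur pr).
Hypotheses (hduh : dprimal_sol a l Vh i mu uh duh)
  (hdur : dprimal_sol a l Vpr i mu ur dur).
Hypotheses (hdph : ddual_sol a k j Vh i mu uh ph duh dph)
  (hdpr : ddual_sol a k j Vdu i mu ur pr dur dpr).

Let Vh_subr : {in Vh &, forall u v, u - v \in Vh}.
Proof. exact: (GRing.submod_closedB Vh_sub).2. Qed.

Let primal_mem : uh - ur \in Vh.
Proof. by apply: Vh_subr; [case: huh|apply: Vpr_Vh; case: hur]. Qed.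

Let dual_mem : ph - pr \in Vh.
Proof. by apply: Vh_subr; [case: hph|apply: Vdu_Vh; case: hpr]. Qed.

Let dprimal_mem : duh - dur \in Vh.
Proof. by apply: Vh_subr; [case: hduh|apply: Vpr_Vh; case: hdur]. Qed.

Let ddual_mem : dph - dpr \in Vh.
Proof. by apply: Vh_subr; [case: hdph|apply: Vdu_Vh; case: hdpr]. Qed.

Lemma primal_error : `|uh - ur| <= Delta_pr a l Vh mu ur.
Proof.
apply: coercive_error => //; first exact: dual_norm_ge0.
have [_ eqh] := huh.
have -> : bil a mu (uh - ur) (uh - ur) = res_pr a l mu ur (uh - ur).
  by rewrite linearBl /= eqh.
exact: le_trans (ler_norm _) (dual_normP hV Vh_fin _ _).
Qed.

(** Replacing [uh] by [ur] on the right-hand side leaves the dual residual and the extra term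
    [2 * bil k mu e (uh - ur)]. *)
Lemma dual_error : `|ph - pr| <= Delta_du a k l j Vh mu ur pr.
Proof.
(* An estimator that dominates a norm is nonnegative, which yields the premise [0 <= D] of
   [coercive_error]. *)
have pr_ge0 := le_trans (normr_ge0 _) primal_error.
apply: coercive_error => //.
  by rewrite addr_ge0 ?dual_norm_ge0 // mulr_ge0 // ?mulr_ge0
             ?continuity_const_ge0.
set e := ph - pr; have [_ eqh] := hph.
have -> : bil a mu e e = 2 * bil k mu e (uh - ur) + res_du a k j mu ur pr e.
  (* Only the solution slot is unfolded; the other [e] stays as the test vector for [eqh]. *)
  by rewrite {2}/e linearBr /= eqh // linearBr /= /res_du; ring.
have := form_le_r hV Vh_fin (bil k mu) dual_mem primal_mem primal_error.
have := dual_normP hV Vh_fin (res_du a k j mu ur pr) dual_mem.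
by rewrite -/e /= !ler_norml => /andP[_ ?] /andP[_ ?]; lra.
Qed.

Lemma dprimal_error : `|duh - dur| <= Delta_dpr a l Vh i mu ur dur.
Proof.
have pr_ge0 := le_trans (normr_ge0 _) primal_error.
apply: coercive_error => //.
  by rewrite addr_ge0 ?dual_norm_ge0 // mulr_ge0 // ?mulr_ge0
             ?continuity_const_ge0.
set e := duh - dur; have [_ eqh] := hduh.
have -> : bil a mu e e = sens_res_pr a l i mu ur dur e - dbil i a mu (uh - ur) e.
  rewrite {1}/e linearBl /= eqh // linearBl /=.
  by rewrite /sens_res_pr /dres_pr; ring.
have := form_le_l hV Vh_fin (dbil i a mu) primal_mem dprimal_mem primal_error.
have := dual_normP hV Vh_fin (sens_res_pr a l i mu ur dur) dprimal_mem.
by rewrite -/e /= !ler_norml => /andP[_ ?] /andP[? _]; lra.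
Qed.

(** Replacing [uh], [ph] and [duh] by their reduced counterparts produces one extra term each,
    controlled by the three previous estimates. *)
Lemma ddual_error :
  `|dph - dpr| <= Delta_ddu a k l j Vh i mu ur pr dur dpr.
Proof.
have pr_ge0 := le_trans (normr_ge0 _) primal_error.
have du_ge0 := le_trans (normr_ge0 _) dual_error.
have dpr_ge0 := le_trans (normr_ge0 _) dprimal_error.
apply: coercive_error => //.
  by rewrite !addr_ge0 ?dual_norm_ge0 // mulr_ge0 // ?mulr_ge0
             ?continuity_const_ge0.
set e := dph - dpr; have [_ eqh] := hdph.
have -> : bil a mu e e = sens_res_du a k j i mu ur pr dur dpr e +
    2 * dbil i k mu e (uh - ur) - dbil i a mu e (ph - pr) +
    2 * bil k mu e (duh - dur).
  rewrite {2}/e linearBr /= eqh // !linearBr /=.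
  by rewrite /sens_res_du /dres_du; ring.
have := form_le_r hV Vh_fin (dbil i k mu) ddual_mem primal_mem primal_error.
have := form_le_r hV Vh_fin (dbil i a mu) ddual_mem dual_mem dual_error.
have := form_le_r hV Vh_fin (bil k mu) ddual_mem dprimal_mem dprimal_error.
have := dual_normP hV Vh_fin (sens_res_du a k j i mu ur pr dur dpr) ddual_mem.
(* The term in [dbil i a] carries a minus sign, so the lower half of its two-sided bound is kept;
   the upper half is kept for the others. *)
rewrite -/e /= !ler_norml => /andP[_ ?] /andP[_ ?] /andP[? _] /andP[_ ?]; lra.
Qed.

End Estimators.

Theorem proposition2p12 (R : realType) (V : completeNormedModType R)
  (hV : is_hilbert V)
  (P : nat) (mua mub : 'rV[R]_P)
  (a k : sep_bilform V P) (l j : sep_linform V P) (Theta : 'rV[R]_P -> R)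
  (a_cont : forall mu, box mua mub mu -> continuous_form (bil a mu))
  (a_coer : forall mu, box mua mub mu -> coercive_form (bil a mu))
  (a_sym : forall mu, box mua mub mu ->
     forall u v, bil a mu u v = bil a mu v u)
  (k_cont : forall mu, box mua mub mu -> continuous_form (bil k mu))
  (k_sym : forall mu, box mua mub mu ->
     forall u v, bil k mu u v = bil k mu v u)
  (l_cont : forall mu, box mua mub mu -> continuous (lin l mu))
  (j_cont : forall mu, box mua mub mu -> continuous (lin j mu))
  (a_diff : forall q mu, box mua mub mu ->
     twice_differentiable_at (bil_coef a q) mu)
  (k_diff : forall q mu, box mua mub mu ->
     twice_differentiable_at (bil_coef k q) mu)
  (l_diff : forall q mu, box mua mub mu ->
     twice_differentiable_at (lin_coef l q) mu)
  (j_diff : forall q mu, box mua mub mu ->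
     twice_differentiable_at (lin_coef j q) mu)
  (J_diff : forall u mu, box mua mub mu ->
     twice_differentiable_at (objective k j Theta u) mu)
  (Vh Vpr Vdu : {pred V})
  (Vh_sub : GRing.submod_closed Vh) (Vh_fin : finite_dimensional Vh)
  (Vpr_sub : GRing.submod_closed Vpr) (Vpr_Vh : {subset Vpr <= Vh})
  (Vdu_sub : GRing.submod_closed Vdu) (Vdu_Vh : {subset Vdu <= Vh})
  (mu : 'rV[R]_P) (hmu : box mua mub mu) (i : 'I_P)
  (uh ph duh dph ur pr dur dpr : V)
  (huh : primal_sol a l Vh mu uh)
  (hph : dual_sol a k j Vh mu uh ph)
  (hduh : dprimal_sol a l Vh i mu uh duh)
  (hdph : ddual_sol a k j Vh i mu uh ph duh dph)
  (hur : primal_sol a l Vpr mu ur)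
  (hpr : dual_sol a k j Vdu mu ur pr)
  (hdur : dprimal_sol a l Vpr i mu ur dur)
  (hdpr : ddual_sol a k j Vdu i mu ur pr dur dpr) :
  `|dph - dpr| <= Delta_ddu a k l j Vh i mu ur pr dur dpr.

Proof.
exact: (ddual_error hV Vh_sub Vh_fin Vpr_Vh Vdu_Vh (a_coer mu hmu)
  huh hur hph hpr hduh hdur hdph hdpr).
Qed.
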